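(* Let $\mathcal{RS}$ be a Riemann solver for a node $J$ with two incoming arcs (indices $1,2$) and two outgoing arcs (indices $3,4$), with flux $f$, and let $(\bar\rho_1,\bar\rho_2,\bar\rho_3,\bar\rho_4)$ be an equilibrium for $\mathcal{RS}$ with $\bar\rho_1\le\bar\rho_2$ and $\bar\rho_3\le\bar\rho_4$. Assume that the equilibrium is composed of three bad data and one good datum. 1. Assume that $\bar\rho_2\ge\sigma$, i.e. the good datum is in an incoming arc. If $\mathcal F(\mathcal{RS}(\rho_{1,0},\dots,\rho_{4,0}),k)\ge0$ for every initial datum $(\rho_{1,0},\dots,\rho_{4,0})\in[0,1]^4$ and every $k\in[0,1]$, then $\bar\rho_1<\sigma$, $\bar\rho_3>\sigma$, $\bar\rho_2\le\bar\rho_4$ and $f(\bar\rho_1)\le\max\{f(\bar\rho_2),f(\bar\rho_3)\}$. Conversely, if $\bar\rho_1<\sigma$, $\bar\rho_3>\sigma$, $\bar\rho_2\le\bar\rho_4$ and $f(\bar\rho_1)\le\max\{f(\bar\rho_2),f(\bar\rho_3)\}$, then $\mathcal F(\bar\rho_1,\bar\rho_2,\bar\rho_3,\bar\rho_4,k)\ge0$ for every $k\in[0,1]$. 2. Assume that $\bar\rho_3\le\sigma$, i.e. the good datum is in an outgoing arc. If $\mathcal F(\mathcal{RS}(\rho_{1,0},\dots,\rho_{4,0}),k)\ge0$ for every initial datum $(\rho_{1,0},\dots,\rho_{4,0})\in[0,1]^4$ and every $k\in[0,1]$, then $\bar\rho_2<\sigma$, $\bar\rho_4>\sigma$, $\bar\rho_3\ge\bar\rho_1$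 and $f(\bar\rho_4)\le\max\{f(\bar\rho_2),f(\bar\rho_3)\}$. Conversely, if $\bar\rho_2<\sigma$, $\bar\rho_4>\sigma$, $\bar\rho_3\ge\bar\rho_1$ and $f(\bar\rho_4)\le\max\{f(\bar\rho_2),f(\bar\rho_3)\}$, then $\mathcal F(\bar\rho_1,\bar\rho_2,\bar\rho_3,\bar\rho_4,k)\ge0$ for every $k\in[0,1]$.
   Context: Flux: $f:[0,1]\to\mathbb R$ is a continuous, piecewise smooth, concave function with $f(0)=f(1)=0$, and there is a unique $\sigma\in\,]0,1[$ such that $f$ is strictly increasing on $[0,\sigma[$ and strictly decreasing on $]\sigma,1]$. Let $\tau:[0,1]\to[0,1]$ be the map with $f(\tau(\rho))=f(\rho)$ for all $\rho\in[0,1]$ and $\tau(\rho)\neq\rho$ for all $\rho\ne\sigma$. Convention: $\mathrm{sgn}(0)=0$. Riemann solver (two incoming, two outgoing arcs): a function $\mathcal{RS}:[0,1]^4\to[0,1]^4$, $(\rho_{1,0},\dots,\rho_{4,0})\mapsto(\bar\rho_1,\dots,\bar\rho_4)$, such that for every initial datum: (1) $f(\bar\rho_1)+f(\bar\rho_2)=f(\bar\rho_3)+f(\bar\rho_4)$; (2) for $i\in\{1,2\}$ the classical Riemann problem for $\rho_t+f(\rho)_x=0$ with left state $\rho_{i,0}$ and right state $\bar\rho_i$ is solved with waves with negative speed; that is, $\bar\rho_i\in\{\rho_{i,0}\}\cup\,]\tau(\rho_{i,0}),1]$ if $\rho_{i,0}\le\sigma$ and $\bar\rho_i\in[\sigma,1]$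 if $\rho_{i,0}\ge\sigma$; (3) for $j\in\{3,4\}$ the classical Riemann problem with left state $\bar\rho_j$ and right state $\rho_{j,0}$ is solved with waves with positive speed; that is, $\bar\rho_j\in[0,\sigma]$ if $\rho_{j,0}\le\sigma$ and $\bar\rho_j\in\{\rho_{j,0}\}\cup[0,\tau(\rho_{j,0})[$ if $\rho_{j,0}\ge\sigma$. An equilibrium for $\mathcal{RS}$ is a fixed point of $\mathcal{RS}$. Good and bad data: a datum $\rho$ in an incoming arc is good if $\rho\in[\sigma,1]$ and bad if $\rho\in[0,\sigma[$; a datum $\rho$ in an outgoing arc is good if $\rho\in[0,\sigma]$ and bad if $\rho\in\,]\sigma,1]$. Entropy-flux function: $\mathcal F(\rho_1,\rho_2,\rho_3,\rho_4,k)=\sum_{i=1}^2\mathrm{sgn}(\rho_i-k)(f(\rho_i)-f(k))-\sum_{j=3}^4\mathrm{sgn}(\rho_j-k)(f(\rho_j)-f(k))$. (E1): $\mathcal{RS}$ satisfies (E1) if $\mathcal F(\mathcal{RS}(\rho_{1,0},\dots,\rho_{4,0}),k)\ge0$ for every initial datum $(\rho_{1,0},\dots,\rho_{4,0})\in[0,1]^4$ and every $k\in[0,1]$. *)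

(* Defs.v *)
From HB Require Import structures.
From mathcomp Require Import all_boot all_order all_algebra.
From mathcomp Require Import all_classical all_reals all_analysis.

Set Implicit Arguments.
Unset Strict Implicit.
Unset Printing Implicit Defensive.

Import Order.TTheory GRing.Theory Num.Theory.
Import numFieldNormedType.Exports.

Local Open Scope classical_set_scope.
Local Open Scope ring_scope.

(* Functions on [0, 1] (resp. [0, 1]^4) are total functions on R (resp. R^4);
   every condition below only involves arguments in [0, 1]. *)

Definition concave_on (R : realType) (D : set R) (f : R -> R) : Prop :=
  convex_function (E := R^o) D (fun x => - f x).

(* Away from a finite set of breakpoints f is C^oo; as that region is open, the
   iterated total derivatives [derive1n n f] are the genuine ones there. *)
Definition piecewise_smooth01 (R : realType) (f : R -> R) : Prop :=
  exists breaks : seq R, forall x : R, x \in `]0, 1[ -> x \notin breaks ->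
    forall n : nat, derivable (derive1n n f) x 1.

Definition unimodal_at (R : realType) (f : R -> R) (sigma : R) : Prop :=
  [/\ sigma \in `]0, 1[,
      {in `[0, sigma[ &, {homo f : x y / x < y}} &
      {in `]sigma, 1] &, {homo f : x y / x < y >-> y < x}}].

Record is_flux (R : realType) (f : R -> R) (sigma : R) : Prop := IsFlux {
  flux_continuous : {within `[0, 1], continuous f};
  flux_piecewise_smooth : piecewise_smooth01 f;
  flux_concave : concave_on `[0, 1] f;
  flux_at0 : f 0 = 0;
  flux_at1 : f 1 = 0;
  flux_unimodal : unique (unimodal_at f) sigma }.

Definition is_tau (R : realType) (f : R -> R) (sigma : R) (tau : R -> R) :
    Prop :=
  forall rho : R, rho \in `[0, 1] ->
    [/\ tau rho \in `[0, 1], f (tau rho) = f rho &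
        rho != sigma -> tau rho != rho].

(* Densities (rho_1, rho_2, rho_3, rho_4) at the node: arcs 1 and 2 are
   incoming, arcs 3 and 4 are outgoing. *)
Definition state (R : realType) : Type := (R * R * R * R)%type.

Definition in_cube (R : realType) (r : state R) : Prop :=
  let: (r1, r2, r3, r4) := r in
  [/\ r1 \in `[0, 1], r2 \in `[0, 1], r3 \in `[0, 1] & r4 \in `[0, 1]].

(* r0 is the initial density of the arc and r its trace at the node. *)
Definition incoming_admissible (R : realType) (sigma : R) (tau : R -> R)
    (r0 r : R) : Prop :=
  (r0 <= sigma -> r = r0 \/ r \in `]tau r0, 1]) /\
  (sigma <= r0 -> r \in `[sigma, 1]).

Definition outgoing_admissible (R : realType) (sigma : R) (tau : R -> R)
    (r0 r : R) : Prop :=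
  (r0 <= sigma -> r \in `[0, sigma]) /\
  (sigma <= r0 -> r = r0 \/ r \in `[0, tau r0[).

Definition riemann_solver (R : realType) (f : R -> R) (sigma : R)
    (tau : R -> R) (RS : state R -> state R) : Prop :=
  forall r0 : state R, in_cube r0 -> in_cube (RS r0) /\
    let: (r10, r20, r30, r40) := r0 in
    let: (r1, r2, r3, r4) := RS r0 in
    [/\ f r1 + f r2 = f r3 + f r4,
        incoming_admissible sigma tau r10 r1 /\
        incoming_admissible sigma tau r20 r2 &
        outgoing_admissible sigma tau r30 r3 /\
        outgoing_admissible sigma tau r40 r4].

Definition equilibrium (R : realType) (RS : state R -> state R) (r : state R) :
    Prop :=
  in_cube r /\ RS r = r.

Definition good_in (R : realType) (sigma r : R) : bool := r \in `[sigma, 1].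
Definition bad_in (R : realType) (sigma r : R) : bool := r \in `[0, sigma[.
Definition good_out (R : realType) (sigma r : R) : bool := r \in `[0, sigma].
Definition bad_out (R : realType) (sigma r : R) : bool := r \in `]sigma, 1].

Definition num_good (R : realType) (sigma : R) (r : state R) : nat :=
  let: (r1, r2, r3, r4) := r in
  (good_in sigma r1 + good_in sigma r2 + good_out sigma r3
    + good_out sigma r4)%N.

Definition num_bad (R : realType) (sigma : R) (r : state R) : nat :=
  let: (r1, r2, r3, r4) := r in
  (bad_in sigma r1 + bad_in sigma r2 + bad_out sigma r3 + bad_out sigma r4)%N.

Definition entropy_flux (R : realType) (f : R -> R) (r : state R) (k : R) : R :=
  let: (r1, r2, r3, r4) := r in
  Num.sg (r1 - k) * (f r1 - f k) + Num.sg (r2 - k) * (f r2 - f k)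
  - (Num.sg (r3 - k) * (f r3 - f k) + Num.sg (r4 - k) * (f r4 - f k)).

Definition E1 (R : realType) (f : R -> R) (RS : state R -> state R) : Prop :=
  forall r0 : state R, in_cube r0 ->
    forall k : R, k \in `[0, 1] -> 0 <= entropy_flux f (RS r0) k.

(* Main.v *)
Require Import Defs.
From mathcomp Require Import all_boot all_order all_algebra.
From mathcomp Require Import all_classical all_reals all_analysis.
From mathcomp Require Import lra.

Set Implicit Arguments.
Unset Strict Implicit.

Import Order.TTheory GRing.Theory Num.Theory.
Import numFieldNormedType.Exports.

Local Open Scope ring_scope.

(** Write [f_i] for [f rho_i].  In the first case, three bad data and a good
    incoming one mean [rho1 < sigma <= rho2] and [sigma < rho3 <= rho4].
    Conservation reads [f_1 - f_3 = f_4 - f_2], and [f] decreases on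
    [[sigma, 1]], so everything depends on the position of [rho2] relative to
    [rho4].

    If [rho4 < rho2], the entropy flux at [k = rho4] is [2 (f_2 - f_4)], which
    is negative ([entropy_incoming_good_le]).  If [rho2 <= rho4], then
    [f_4 <= f_2], hence [f_1 <= f_3], which already gives the bound on [f_1]
    ([incoming_bad_flux_le]).  The entropy flux at [k] then vanishes outside
    [[rho1, rho4]], and on each interval cut out by the four densities it is a
    positive multiple of one of [f k - f_1], [f_3 - f_1], [f k - f_4] or
    [2 f k - f_3 - f_4].  The first is nonnegative because a function with a
    single peak is, on an interval, at least the smaller of its two end values;
    the others are so by monotonicity ([entropy_incoming_good]).

    The second case is the first one seen through the reflection
    [x |-> 1 - x], which exchanges incoming and outgoing arcs and leaves the
    entropy flux unchanged ([entropy_flux_mirror]).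

    The condition (E1) enters through the initial datum [(rho1, ..., rho4)]
    itself, which the solver fixes. *)

(** * Fluxes with a single peak *)

(** Both intervals are closed at the peak because the good datum may be [sigma]
    itself; in this form the property is invariant under reflection. *)
Definition peaked_at (R : realType) (f : R -> R) (sigma : R) : Prop :=
  {in `[0, sigma] &, {homo f : x y / x < y}} /\
  {in `[sigma, 1] &, {homo f : x y / x < y >-> y < x}}.

(** Continuity extends monotonicity to the end point.  A weak inequality passes
    to the limit; comparing first with the midpoint of [x] and [b] keeps it
    strict. *)
Lemma homo_lt_right_end (R : realType) (f : R -> R) (a b : R) :
  {in `[a, b[ &, {homo f : x y / x < y}} -> {for b, continuous f} ->
  {in `[a, b] &, {homo f : x y / x < y}}.
Proof.
move=> incr fb x y; rewrite !in_itv/= => /andP[ax _] /andP[ay].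
rewrite le_eqVlt => /predU1P[->|yb] xy; last first.
  by apply: incr; rewrite ?in_itv/= ?ax ?ay ?yb// (lt_trans xy).
set m := (x + b) / 2.
have [xm mb] : x < m /\ m < b by rewrite /m; split; lra.
have am : a <= m by apply: le_trans ax (ltW xm).
have fxm : f x < f m by apply: incr => //; rewrite in_itv/= ?ax ?am//.
apply: (lt_le_trans fxm).
apply: (cvgr_to_ge (F := at_left b) (f := f)) => //.
  exact: cvg_at_left_filter.
near=> z.
have mz : m < z by near: z; exact: nbhs_left_gt.
have zb : z < b by near: z; exact: nbhs_left_lt.
by apply/ltW/incr => //; rewrite in_itv/= ?am ?mb ?zb ?(le_trans am (ltW mz)).
Unshelve. all: by end_near. Qed.

Lemma flux_peaked (R : realType) (f : R -> R) (sigma : R) :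
  is_flux f sigma -> peaked_at f sigma.
Proof.
move=> [fc _ _ _ _ [[s01 incr decr] _]].
have /(continuous_within_itvP _ (@ltr01 R))[/(_ _ s01) fs _ _] := fc.
split; first exact: homo_lt_right_end.
(* The decreasing branch is an increasing one after reflection, with [sigma]
   again at its right end. *)
have decr' : {in `[0, (1 - sigma)] &,
    {homo (fun x => f (1 - x)) : x y / x < y}}.
  apply: homo_lt_right_end => [x y|].
    rewrite !in_itv/= => /andP[x0 xs] /andP[y0 ys] xy.
    by apply: decr; rewrite ?in_itv/=; lra.
  apply: continuous_comp; last by rewrite subKr.
  by apply: cvgB; [exact: cvg_cst|exact: cvg_id].
move=> x y; rewrite !in_itv/= => /andP[xs x1] /andP[ys y1] xy.
rewrite -(subKr 1 x) -(subKr 1 y).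
by apply: decr'; rewrite ?in_itv/=; lra.
Qed.

Lemma peaked_incr (R : realType) (f : R -> R) (sigma x y : R) :
  peaked_at f sigma -> 0 <= x -> x <= y -> y <= sigma -> f x <= f y.
Proof.
move=> [incr _] x0; rewrite le_eqVlt => /predU1P[->//|xy] ys.
by apply/ltW/incr; rewrite ?in_itv/=; lra.
Qed.

Lemma peaked_decr (R : realType) (f : R -> R) (sigma x y : R) :
  peaked_at f sigma -> sigma <= x -> x <= y -> y <= 1 -> f y <= f x.
Proof.
move=> [_ decr] sx; rewrite le_eqVlt => /predU1P[->//|xy] y1.
by apply/ltW/decr; rewrite ?in_itv/=; lra.
Qed.

(** This is quasi-concavity: depending on the side of the peak on which [k]
    lies, [f k] is at least the value at the left or at the right end. *)
Lemma peaked_ge (R : realType) (f : R -> R) (sigma c x y k : R) :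
  peaked_at f sigma -> 0 <= x -> y <= 1 -> x <= k <= y ->
  c <= f x -> c <= f y -> c <= f k.
Proof.
move=> fP x0 y1 /andP[xk ky] cx cy; have [ks|/ltW sk] := leP k sigma.
- exact: le_trans cx (peaked_incr fP x0 xk ks).
- exact: le_trans cy (peaked_decr fP sk ky y1).
Qed.

(** * The entropy flux with a good incoming datum *)

(** When [r = k] both one-sided values of this term of the entropy flux vanish,
    so weak inequalities suffice and the densities themselves need no separate
    treatment when [k] runs through an interval between them. *)
Lemma sg_flux_le (R : realType) (f : R -> R) (r k : R) :
  r <= k -> Num.sg (r - k) * (f r - f k) = f k - f r.
Proof.
rewrite le_eqVlt => /predU1P[->|rk]; first by rewrite !subrr mulr0.
by rewrite ltr0_sg ?subr_lt0// mulN1r opprB.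
Qed.

Lemma sg_flux_ge (R : realType) (f : R -> R) (r k : R) :
  k <= r -> Num.sg (r - k) * (f r - f k) = f r - f k.
Proof.
rewrite le_eqVlt => /predU1P[->|rk]; first by rewrite !subrr mulr0.
by rewrite gtr0_sg ?subr_gt0// mul1r.
Qed.

(** If [r4 < r2], then [k = r4] separates [r2] from the three other densities,
    and conservation turns the entropy flux into [2 (f r2 - f r4) < 0]. *)
Lemma entropy_incoming_good_le (R : realType) (f : R -> R)
    (sigma r1 r2 r3 r4 : R) :
  peaked_at f sigma -> 0 <= r1 -> r1 < sigma <= r2 -> sigma < r3 <= r4 ->
  r2 <= 1 -> f r1 + f r2 = f r3 + f r4 ->
  (forall k, k \in `[0, 1] -> 0 <= entropy_flux f (r1, r2, r3, r4) k) ->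
  r2 <= r4.
Proof.
move=> [_ decr] r10 /andP[r1s sr2] /andP[sr3 r34] r21 cons pos.
rewrite leNgt; apply/negP => r42.
have f24 : f r2 < f r4 by apply: decr; rewrite ?in_itv/=; lra.
have := pos r4; rewrite /entropy_flux in_itv/=.
rewrite (sg_flux_le f (_ : r1 <= r4)); last lra.
rewrite (sg_flux_ge f (ltW r42)) (sg_flux_le f r34) (sg_flux_le f (lexx r4)).
by move=> /(_ ltac:(lra)); lra.
Qed.

Lemma incoming_bad_flux_le (R : realType) (f : R -> R) (sigma r1 r2 r3 r4 : R) :
  peaked_at f sigma -> sigma <= r2 -> r2 <= r4 -> r4 <= 1 ->
  f r1 + f r2 = f r3 + f r4 -> f r1 <= f r3.
Proof. by move=> fP sr2 r24 r41; have := peaked_decr fP sr2 r24 r41; lra. Qed.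

(** Conservation makes the sum vanish for [k] below or above all densities.  In
    between, the four positions of [k] relative to [r2] and [r3] each leave a
    quantity whose sign follows from [f r1 <= f r3] and monotonicity. *)
Lemma entropy_incoming_good (R : realType) (f : R -> R)
    (sigma r1 r2 r3 r4 : R) :
  peaked_at f sigma -> 0 <= r1 -> r1 < sigma <= r2 -> sigma < r3 <= r4 ->
  r4 <= 1 -> f r1 + f r2 = f r3 + f r4 -> r2 <= r4 ->
  forall k, 0 <= entropy_flux f (r1, r2, r3, r4) k.
Proof.
move=> fP r10 /andP[r1s sr2] /andP[sr3 r34] r41 cons r24 k.
have f13 := incoming_bad_flux_le fP sr2 r24 r41 cons.
have f43 := peaked_decr fP (ltW sr3) r34 r41.
rewrite /entropy_flux.
have [k1|/ltW k1] := leP k r1.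
  by rewrite !sg_flux_ge; lra.
have [k4|/ltW k4] := leP r4 k.
  by rewrite !sg_flux_le; lra.
rewrite (sg_flux_le f k1) (sg_flux_ge f k4).
have [k2|/ltW k2] := leP k r2; have [k3|/ltW k3] := leP k r3.
- rewrite (sg_flux_ge f k2) (sg_flux_ge f k3).
  (* Here [k] lies between [r1] and the smaller of [r2] and [r3], where the
     flux is at least [f r1] in either order. *)
  have f12 : r2 <= r3 -> f r1 <= f r2.
    by move=> r23; apply: le_trans f13 (peaked_decr fP sr2 r23 _); lra.
  have : f r1 <= f k.
    have [/f12|/ltW r32] := leP r2 r3.
    + by move=> ?; apply: (peaked_ge (x := r1) (y := r2) fP); lra.
    + by apply: (peaked_ge (x := r1) (y := r3) fP); lra.
  by lra.
- by rewrite (sg_flux_ge f k2) (sg_flux_le f k3); lra.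
- rewrite (sg_flux_le f k2) (sg_flux_ge f k3).
  by have := peaked_decr fP (le_trans sr2 k2) k3; lra.
- rewrite (sg_flux_le f k2) (sg_flux_le f k3).
  by have := peaked_decr fP (le_trans sr2 k2) k4; lra.
Qed.

(** * Reflection *)

Lemma peaked_mirror (R : realType) (f : R -> R) (sigma : R) :
  peaked_at f sigma -> peaked_at (fun x => f (1 - x)) (1 - sigma).
Proof.
move=> [incr decr]; split=> x y; rewrite !in_itv/= => xs ys xy.
- by apply: decr; rewrite ?in_itv/=; lra.
- by apply: incr; rewrite ?in_itv/=; lra.
Qed.

(** The sign of each [rho - k] changes, and so does the sign with which each arc
    is counted, since incoming arcs become outgoing.  Reversing the order of the
    arcs also preserves the conventions [r1 <= r2] and [r3 <= r4]. *)
Lemma entropy_flux_mirror (R : realType) (f : R -> R) (r1 r2 r3 r4 k : R) :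
  entropy_flux (fun x => f (1 - x)) (1 - r4, 1 - r3, 1 - r2, 1 - r1) (1 - k) =
  entropy_flux f (r1, r2, r3, r4) k.
Proof.
have sgE r : Num.sg (1 - r - (1 - k)) = - Num.sg (r - k).
  by rewrite -sgrN; congr Num.sg; lra.
by rewrite /entropy_flux !sgE !subKr; lra.
Qed.

Theorem proposition4p5 (R : realType) (f : R -> R) (sigma : R) (tau : R -> R)
    (RS : state R -> state R) (rho1 rho2 rho3 rho4 : R)
    (f_flux : is_flux f sigma) (tauP : is_tau f sigma tau)
    (RS_solver : riemann_solver f sigma tau RS)
    (rho_eq : equilibrium RS (rho1, rho2, rho3, rho4))
    (le12 : rho1 <= rho2) (le34 : rho3 <= rho4)
    (three_bad : num_bad sigma (rho1, rho2, rho3, rho4) = 3%N)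
    (one_good : num_good sigma (rho1, rho2, rho3, rho4) = 1%N) :
  (sigma <= rho2 ->
     (E1 f RS ->
        [/\ rho1 < sigma, sigma < rho3, rho2 <= rho4 &
            f rho1 <= Num.max (f rho2) (f rho3)]) /\
     ([/\ rho1 < sigma, sigma < rho3, rho2 <= rho4 &
          f rho1 <= Num.max (f rho2) (f rho3)] ->
        forall k : R, k \in `[0, 1] ->
          0 <= entropy_flux f (rho1, rho2, rho3, rho4) k)) /\
  (rho3 <= sigma ->
     (E1 f RS ->
        [/\ rho2 < sigma, sigma < rho4, rho1 <= rho3 &
            f rho4 <= Num.max (f rho2) (f rho3)]) /\
     ([/\ rho2 < sigma, sigma < rho4, rho1 <= rho3 &
          f rho4 <= Num.max (f rho2) (f rho3)] ->
        forall k : R, k \in `[0, 1] ->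
          0 <= entropy_flux f (rho1, rho2, rho3, rho4) k)).
Proof.
have fP := flux_peaked f_flux.
case: rho_eq => cube fixed.
have cons : f rho1 + f rho2 = f rho3 + f rho4.
  by have [_] := RS_solver _ cube; rewrite fixed => -[].
have E1_eq : E1 f RS -> forall k, k \in `[0, 1] ->
    0 <= entropy_flux f (rho1, rho2, rho3, rho4) k.
  by move=> /(_ _ cube); rewrite fixed.
have [/andP[r10 r11] /andP[r20 r21] /andP[r30 r31] /andP[r40 r41]] :
    [/\ 0 <= rho1 <= 1, 0 <= rho2 <= 1, 0 <= rho3 <= 1 & 0 <= rho4 <= 1].
  by move: cube; rewrite /in_cube !in_itv.
(* Inside the unit interval a datum is bad when it is not good, so counting the
   good data determines the side of [sigma] on which each density lies. *)
have {one_good} good1 : ((sigma <= rho1)%R + (sigma <= rho2)%R +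
    (rho3 <= sigma)%R + (rho4 <= sigma)%R = 1)%N.
  move: one_good; rewrite /num_good /good_in /good_out !in_itv/=.
  by rewrite !(andbT, andTb, r11, r21, r30, r40).
split=> [s2|s3].
- have [r1s s3] : rho1 < sigma /\ sigma < rho3.
    by move: good1; rewrite s2; case: leP => _; case: leP => // _; case: leP.
  split=> [/E1_eq pos|[_ _ r24 _] k _].
    have r24 : rho2 <= rho4.
      by apply: (entropy_incoming_good_le fP) pos; lra.
    by split=> //; rewrite le_max (incoming_bad_flux_le fP s2 r24 r41 cons) orbT.
  by apply: (entropy_incoming_good fP); lra.
- have [r2s s4] : rho2 < sigma /\ sigma < rho4.
    by move: good1; rewrite s3; case: leP => _; case: leP => // _; case: leP.
  have gP := peaked_mirror fP.
  have g_cons : f (1 - (1 - rho4)) + f (1 - (1 - rho3)) =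
      f (1 - (1 - rho2)) + f (1 - (1 - rho1)).
    by rewrite !subKr; lra.
  split=> [/E1_eq pos|[_ _ r13 _] k _].
    have r13 : 1 - rho3 <= 1 - rho1.
      apply: (entropy_incoming_good_le gP _ _ _ _ g_cons); try lra.
      move=> k k01; rewrite -(subKr 1 k) entropy_flux_mirror.
      by apply: pos; move: k01; rewrite !in_itv/=; lra.
    have := incoming_bad_flux_le gP _ r13 _ g_cons.
    rewrite !subKr => f42.
    by split=> //; [lra|rewrite le_max f42//; lra].
  rewrite -entropy_flux_mirror.
  by apply: (entropy_incoming_good gP _ _ _ _ g_cons); lra.
Qed.
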